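(* Let $\sigma$ be a bounded endomorphism on a Banach algebra $\mathcal{A}$. Then there are no three elements $a,b,c\in\mathcal{A}$ such that $a\sigma(b)-\sigma(b)a=c$ and all of the following conditions hold: (i) $\sigma(a)\sigma^2(b)-\sigma^2(b)\sigma(a)=a\sigma(b)-\sigma(b)a$; (ii) $(\sigma^2(b)-\sigma(b))a=a(\sigma^2(b)-\sigma(b))$; (iii) $a\sigma(c)-\sigma(c)a=0$; (iv) $c$ is not quasinilpotent.
   Context: An endomorphism of $\mathcal{A}$ is a linear multiplicative map $\mathcal{A}\to\mathcal{A}$. An element $c$ is quasinilpotent if its spectral radius $r(c)=\lim_{n\to\infty}\|c^n\|^{1/n}$ equals $0$. *)

(* Defs.v *)
From HB Require Import structures.
From mathcomp Require Import all_boot all_order all_algebra.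
From mathcomp Require Import complex.
From mathcomp Require Import all_classical all_reals all_analysis.

Set Implicit Arguments.
Unset Strict Implicit.
Unset Printing Implicit Defensive.

Import Order.TTheory GRing.Theory Num.Theory.
Import numFieldNormedType.Exports.

Local Open Scope classical_set_scope.
Local Open Scope ring_scope.

(* A Banach algebra need not have a unit, so the product is that of a
   semigroup (written multiplicatively in the scope %g) and not that of a
   MathComp ring or algebra, which are unital. *)
HB.mixin Record CompleteNormedModule_isBanachAlgebra (K : numFieldType) A
    of CompleteNormedModule K A & Semigroup A := {
  bmulDl : forall x y z : A, ((x + y)%R * z)%g = (x * z)%g + (y * z)%g;
  bmulDr : forall x y z : A, (x * (y + z)%R)%g = (x * y)%g + (x * z)%g;
  bmulZl : forall (k : K) (x y : A), ((k *: x)%R * y)%g = k *: (x * y)%g;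
  bmulZr : forall (k : K) (x y : A), (x * (k *: y)%R)%g = k *: (x * y)%g;
  normM_le : forall x y : A, `|(x * y)%g| <= `|x| * `|y|
}.

#[short(type="banachAlgType")]
HB.structure Definition BanachAlgebra (K : numFieldType) :=
  {A of CompleteNormedModule_isBanachAlgebra K A &
        CompleteNormedModule K A & Semigroup A}.

(* Both real and complex Banach algebras are covered. *)
Variant scalar_field := RealScalars | ComplexScalars.

Definition scalars (R : realType) (F : scalar_field) : numFieldType :=
  match F with
  | RealScalars => R
  | ComplexScalars => R[i]
  end.

Definition real_part (R : realType) (F : scalar_field) : scalars R F -> R :=
  match F with
  | RealScalars => fun x => x
  | ComplexScalars => fun z => complex.Re z
  end.

Section BanachAlgebraTheory.
Variables (R : realType) (F : scalar_field) (A : banachAlgType (scalars R F)).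

(* The norm of a normed module over K takes values in K; here the (real,
   nonnegative) value is read in R. *)
Definition rnorm (x : A) : R := real_part `|x|.

Definition bounded_operator (f : A -> A) : Prop :=
  exists M : R, forall x : A, rnorm (f x) <= M * rnorm x.

(* Without a unit there is no zeroth power: powS c n is c to the n.+1. *)
Definition powS (c : A) (n : nat) : A := iter n (fun x => (c * x)%g) c.

(* limn is a total operator; the limit always exists, by submultiplicativity
   of the norm and Fekete's lemma. *)
Definition spectral_radius (c : A) : R :=
  limn (fun n : nat => rnorm (powS c n) `^ (n.+1%:R)^-1).

Definition quasinilpotent (c : A) : Prop := spectral_radius c = 0.

End BanachAlgebraTheory.

(* Main.v *)
(** Since sigma is multiplicative, (i) says that c is fixed by sigma, and then
    (iii) says that c = [a, y], with y = sigma b, commutes with a.  By the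
    Kleinecke-Shirokov argument such a c is quasinilpotent: the derivation
    D = [a, _] kills c = D y, so the Leibniz rule gives D^n (y^n) = n! c^n,
    hence n! |c^n| <= (2 |a| |y|)^n, and the n-th root of n! tends to
    infinity. *)

Require Import Defs.
From HB Require Import structures.
From mathcomp Require Import all_boot all_order all_algebra.
From mathcomp Require Import complex.
From mathcomp Require Import all_classical all_reals all_analysis.

Import Order.TTheory GRing.Theory Num.Theory.
Import numFieldNormedType.Exports.

Local Open Scope ring_scope.

Section RealPart.
Context {R : realType} {F : scalar_field}.
Implicit Types u v : scalars R F.

Lemma real_part_le u v : u <= v -> real_part u <= real_part v.
Proof.
by case: F u v => //= u v; rewrite lecE => /andP[].
Qed.

Lemma real_partD u v : real_part (u + v) = real_part u + real_part v.
Proof. by case: F u v => //= -[? ?] [? ?]. Qed.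

(** In the complex case [0 <= u] forces the imaginary part of [u] to vanish, so no cross term
    remains. *)
Lemma real_part_ge0M u v :
  0 <= u -> real_part (u * v) = real_part u * real_part v.
Proof.
case: F u v => //= -[u u'] [v v']; rewrite lecE /= => /andP[/eqP -> _].
by rewrite mul0r subr0.
Qed.

Lemma real_part_nat n : real_part (n%:R : scalars R F) = n%:R.
Proof.
elim: n => [|n IHn]; first by case: F.
by rewrite !mulrS real_partD IHn; case: F.
Qed.

End RealPart.

Section RealNorm.
Context {R : realType} {F : scalar_field} {A : banachAlgType (scalars R F)}.
Implicit Types x y : A.

Lemma rnorm_ge0 x : 0 <= rnorm x.
Proof.
rewrite -[0](real_part_nat (F := F) 0).
exact/real_part_le/normr_ge0.
Qed.

Lemma rnormB x y : rnorm (x - y) <= rnorm x + rnorm y.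
Proof. by rewrite /rnorm -real_partD; exact/real_part_le/ler_normB. Qed.

Lemma rnormM x y : rnorm (x * y)%g <= rnorm x * rnorm y.
Proof. by rewrite /rnorm -real_part_ge0M//; exact/real_part_le/normM_le. Qed.

Lemma rnormMn x n : rnorm (x *+ n) = n%:R * rnorm x.
Proof.
rewrite /rnorm -scaler_nat normrZ normr_nat real_part_ge0M ?ler0n//.
by rewrite real_part_nat.
Qed.

Lemma rnorm_powS x n : rnorm (powS x n) <= rnorm x ^+ n.+1.
Proof.
elim: n => [|n IHn]; first by rewrite expr1.
rewrite exprS; apply: le_trans (rnormM _ _) _.
by apply: ler_wpM2l IHn; exact: rnorm_ge0.
Qed.

End RealNorm.

Section Commutator.
Context {R : realType} {F : scalar_field} {A : banachAlgType (scalars R F)}.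
Implicit Types a x y : A.

(** The product of [A] is only a semigroup law, so zero, signs and multiples are passed through it
    as scalars, by bilinearity. *)
Lemma bmul0r x : (0%R * x)%g = 0%R :> A.
Proof. by rewrite -[X in (X * _)%g](scale0r (0 : A)) bmulZl scale0r. Qed.

Lemma bmulr0 x : (x * 0%R)%g = 0%R :> A.
Proof. by rewrite -[X in (_ * X)%g](scale0r (0 : A)) bmulZr scale0r. Qed.

Lemma bmulNr x y : ((- x)%R * y)%g = - (x * y)%g :> A.
Proof. by rewrite -scaleN1r bmulZl scaleN1r. Qed.

Lemma bmulrN x y : (x * (- y)%R)%g = - (x * y)%g :> A.
Proof. by rewrite -scaleN1r bmulZr scaleN1r. Qed.

Lemma bmulrMn x y n : (x * (y *+ n)%R)%g = (x * y)%g *+ n :> A.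
Proof. by rewrite -scaler_nat bmulZr scaler_nat. Qed.

(** The inner derivation induced by [a]. *)
Definition bracket a x : A := (a * x)%g - (x * a)%g.

Lemma bracketD a x y : bracket a (x + y) = bracket a x + bracket a y.
Proof. by rewrite /bracket bmulDl bmulDr opprD addrACA. Qed.

Lemma bracketMn a x n : bracket a (x *+ n) = bracket a x *+ n.
Proof.
elim: n => [|n IHn]; last by rewrite !mulrSr bracketD IHn.
by rewrite !mulr0n /bracket bmul0r bmulr0 subrr.
Qed.

Lemma bracketM a x y :
  bracket a (x * y)%g = (x * bracket a y)%g + (bracket a x * y)%g.
Proof.
rewrite /bracket bmulDl bmulDr bmulNr bmulrN !mulgA [RHS]addrC.
by rewrite addrA subrK.
Qed.

(** Each application of the derivation costs at most a factor [2 * rnorm a], one [rnorm a] for each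
    of its two products. *)
Lemma rnorm_iter_bracket a x n :
  rnorm (iter n (bracket a) x) <= (2 * rnorm a) ^+ n * rnorm x.
Proof.
elim: n => [|n IHn]; first by rewrite expr0 mul1r.
rewrite iterS; apply: le_trans (rnormB _ _) _.
apply: le_trans (lerD (rnormM _ _) (rnormM _ _)) _.
rewrite [X in _ + X]mulrC -mulr2n -[leLHS]mulr_natl exprS -!mulrA ler_pM2l ?ltr0n//.
by apply: ler_wpM2l IHn; exact: rnorm_ge0.
Qed.

Section CommutingCommutator.
Context {a y : A}.
Hypothesis acy : bracket a (bracket a y) = 0.

(** The Leibniz expansion stops after two terms because the second derivative of [y] vanishes.
    Differentiating the second term only raises the order on [x], and the first term yields one new
    copy of it, whence the coefficient [m.+1]. *)
Lemma iter_bracketM x m :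
  iter m.+1 (bracket a) (y * x)%g =
  (y * iter m.+1 (bracket a) x)%g
  + (bracket a y * iter m (bracket a) x)%g *+ m.+1.
Proof.
elim: m => [|m IHm]; first by rewrite /= bracketM mulr1n.
rewrite iterS IHm bracketD bracketMn !bracketM acy bmul0r addr0.
by rewrite -addrA -mulrS.
Qed.

(** The vanishing of one further derivative is carried along in the induction: it removes the term
    that still has the factor [y], leaving [bracket a y] times the previous case. Recall that
    [powS y n] has exponent [n.+1]. *)
Lemma iter_bracket_powS n :
  iter n.+1 (bracket a) (powS y n) = powS (bracket a y) n *+ n.+1`!
  /\ iter n.+2 (bracket a) (powS y n) = 0.
Proof.
elim: n => [|n [IHn IHn0]]; first by rewrite /= mulr1n.
rewrite [powS y _]iterS !iter_bracketM -/(powS _ _).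
rewrite [iter n.+3 _ _]iterS IHn0 IHn bmulr0 add0r.
have -> : bracket a 0 = 0 by rewrite /bracket bmul0r bmulr0 subrr.
rewrite !bmulr0 mul0rn addr0; split=> //.
by rewrite bmulrMn -mulrnA [in RHS]factS mulnC.
Qed.

Lemma kleinecke_shirokov : quasinilpotent (bracket a y).
Proof.
set c := bracket a y; pose M := 2 * rnorm a * rnorm y.
have M_ge0 : 0 <= M by rewrite !mulr_ge0 ?rnorm_ge0.
have powc_le n : rnorm (powS c n) <= M ^+ n.+1 / n.+1`!%:R.
  rewrite ler_pdivlMr ?ltr0n ?fact_gt0// mulrC -rnormMn.
  rewrite -(iter_bracket_powS n).1; apply: le_trans (rnorm_iter_bracket _ _ _) _.
  rewrite [leRHS]exprMn; apply: ler_wpM2l (rnorm_powS _ _).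
  by rewrite exprn_ge0// mulr_ge0 ?rnorm_ge0.
rewrite /quasinilpotent /spectral_radius; apply/cvg_lim => //.
apply/cvgr0Pnorm_le => e e_gt0.
have : ((fun n => exp_coeff (M / e) n.+1) @ \oo --> (0 : R))%classic.
  by rewrite cvg_shiftS; exact: cvg_exp_coeff.
move/cvgr0_norm_le => /(_ 1 ltr01); apply: filterS => n.
rewrite /exp_coeff /= ger0_norm; last first.
  by rewrite divr_ge0// exprn_ge0// divr_ge0// ltW.
rewrite expr_div_n mulrAC ler_pdivrMr ?exprn_gt0// mul1r => Mn_le.
rewrite ger0_norm ?powR_ge0//.
(* With [e] written as a root of its own power, monotonicity of the root reduces the goal to
   comparing powers. *)
have -> : e = (e ^+ n.+1) `^ n.+1%:R^-1.
  by rewrite -powR_mulrn ?ltW// -powRrM mulfV ?pnatr_eq0// powRr1// ltW.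
apply: ge0_ler_powR; rewrite ?invr_ge0 ?ler0n ?nnegrE ?rnorm_ge0//.
  by rewrite exprn_ge0// ltW.
exact: le_trans (powc_le n) Mn_le.
Qed.

End CommutingCommutator.

End Commutator.

Theorem theorem3p10 (R : realType) (F : scalar_field)
    (A : banachAlgType (scalars R F)) (sigma : {linear A -> A})
    (sigmaM : forall x y : A, sigma (x * y)%g = (sigma x * sigma y)%g)
    (sigma_bounded : bounded_operator sigma) :
  ~ exists a b c : A,
      (a * sigma b)%g - (sigma b * a)%g = c /\
      (* (i) *)
      (sigma a * sigma (sigma b))%g - (sigma (sigma b) * sigma a)%g
        = (a * sigma b)%g - (sigma b * a)%g /\
      (* (ii) *)
      ((sigma (sigma b) - sigma b)%R * a)%g
        = (a * (sigma (sigma b) - sigma b)%R)%g /\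
      (* (iii) *)
      (a * sigma c)%g - (sigma c * a)%g = 0 /\
      (* (iv) *)
      ~ quasinilpotent c.
Proof.
move=> [a [b [c [abc [sigma_ab [_ [ac0 []]]]]]]].
have sigma_c : sigma c = c by rewrite -{1}abc linearB !sigmaM sigma_ab.
rewrite -abc; apply: kleinecke_shirokov.
(* The goal is that [a] commutes with [c]; replacing [c] by [sigma c] turns it into (iii). *)
by rewrite /bracket abc -{1 2}sigma_c.
Qed.
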